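(* Let $\Bbbk$ be an algebraically closed field of characteristic $0$ and let $H = H(\mathfrak{gl}(1,1))$ be the bosonization of the enveloping algebra of the Lie superalgebra $\mathfrak{gl}(1,1)$ over $\Bbbk$. Then $H$ is not a finite module over its center, i.e. $H$ is not finitely generated as a module over its center $\mathcal{Z}(H)$.
   Context: $\mathfrak{gl}(1,1)=M_2(\Bbbk)$ is the Lie superalgebra with even part $\mathfrak g_0=\Bbbk x\oplus\Bbbk y$ and odd part $\mathfrak g_1=\Bbbk u\oplus\Bbbk v$, where $x=e_{11}+e_{22}$, $y=e_{11}$, $u=e_{12}$, $v=e_{21}$; $\mathfrak g_0$ is abelian, $[u,v]=x$, $[u,u]=[v,v]=0$, $[x,u]=[x,v]=0$, $[y,u]=u$, $[y,v]=-v$. Its enveloping algebra $U(\mathfrak{gl}(1,1))$ is the associative unital $\Bbbk$-algebra presented by generators $x,y,u,v$ and relations: $x$ is central, $yu-uy=u$, $yv-vy=-v$, $u^2=0$, $v^2=0$, $uv+vu=x$. The bosonization $H(\mathfrak{gl}(1,1))=U(\mathfrak{gl}(1,1))\#\Bbbk C_2$ is, as an algebra, presented by generators $x,y,u,v,t$ with the relations $xy=yx$, $xu=ux$, $xv=vx$, $yu-uy=u$, $yv-vy=-v$, $u^2=0$, $v^2=0$, $uv+vu=x$ together with $t^2=1$, $tx=xt$, $ty=yt$, $tu=-ut$, $tv=-vt$. (It is a Hopf algebra in which $x,y$ are primitive, $u,v$ are $(t,1)$-skew primitive and $t$ is grouplike.) $\mathcal{Z}(H)$ denotes the center of the associative algebra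 $H$. *)

(* Defs.v *)
From HB Require Import structures.
From mathcomp Require Import all_boot all_order all_algebra.
From mathcomp Require Import generic_quotient ring_quotient.
From mathcomp Require Import boolp.
From mathcomp Require Import monalg.

Set Implicit Arguments.
Unset Strict Implicit.
Unset Printing Implicit Defensive.

Import GRing.Theory.
Local Open Scope ring_scope.
Local Open Scope quotient_scope.

Inductive ideal_gen (R : nzRingType) (S : seq R) : R -> Prop :=
| ideal_gen_mem a : a \in S -> ideal_gen S a
| ideal_gen0 : ideal_gen S 0
| ideal_genB a b : ideal_gen S a -> ideal_gen S b -> ideal_gen S (a - b)
| ideal_genM a b c : ideal_gen S b -> ideal_gen S (a * b * c).

HB.mixin Record isTwoSidedIdeal (R : nzRingType) (S : R -> bool) := {
  two_sided_ideal_subproof : (1 \notin S) /\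
    (forall a b, b \in S -> a * b \in S /\ b * a \in S)
}.

#[short(type="twoSidedIdeal")]
HB.structure Definition TwoSidedIdeal (R : nzRingType) :=
  {S of GRing.ZmodClosed R S & isTwoSidedIdeal R S}.

(* ring_quotient only puts a product on quotients of commutative rings, hence
   this noncommutative version. *)
Section AlgQuotient.
Variables (k : comNzRingType) (A : algType k) (I : twoSidedIdeal A).

Definition alg_quot : Type := Quotient.quot I.
HB.instance Definition _ := GRing.Zmodule.on alg_quot.
HB.instance Definition _ := EqQuotient.on alg_quot.

Implicit Types (a b c : A) (q r : alg_quot).
Local Notation Q := alg_quot.

Definition aq_one : Q := \pi_Q 1.
Definition aq_mul q r : Q := \pi_Q (repr q * repr r).
Definition aq_scale (l : k) q : Q := \pi_Q (l *: repr q).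

Lemma ts_idealMl a b : b \in I -> a * b \in I.
Proof. by move=> /(two_sided_ideal_subproof.2 a)[]. Qed.

Lemma ts_idealMr a b : b \in I -> b * a \in I.
Proof. by move=> /(two_sided_ideal_subproof.2 a)[]. Qed.

Lemma aq_piP a b : reflect (\pi_Q a = \pi_Q b) (a - b \in I).
Proof. by rewrite (Quotient.idealrBE I); exact: eqP. Qed.

Lemma aq_piK a : a - repr (\pi_Q a) \in I.
Proof. by apply/aq_piP; rewrite reprK. Qed.

Lemma aq_piD a b : \pi_Q (a + b) = \pi_Q a + \pi_Q b.
Proof. exact: (Quotient.pi_add I). Qed.

Lemma aq_pi0 : \pi_Q 0 = 0.
Proof. by apply: (addrI (\pi_Q 0)); rewrite -aq_piD !addr0. Qed.

Lemma aq_piM a b : \pi_Q (a * b) = aq_mul (\pi_Q a) (\pi_Q b).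
Proof.
apply/aq_piP; set a' := repr _; set b' := repr _.
have -> : a * b - a' * b' = (a - a') * b + a' * (b - b').
  by rewrite mulrBl mulrBr subrKA.
by apply: rpredD; [apply: ts_idealMr|apply: ts_idealMl]; exact: aq_piK.
Qed.

Lemma aq_piZ l a : \pi_Q (l *: a) = aq_scale l (\pi_Q a).
Proof.
by apply/aq_piP; rewrite -scalerBr -[_ - _]mul1r scalerAl ts_idealMl ?aq_piK.
Qed.

Lemma aq_piS (P : Q -> Prop) : (forall a, P (\pi_Q a)) -> forall q, P q.
Proof. by move=> Pp q; rewrite -[q]reprK. Qed.

Lemma aq_mulA : associative aq_mul.
Proof.
by elim/aq_piS=> a; elim/aq_piS=> b; elim/aq_piS=> c; rewrite -!aq_piM mulrA.
Qed.

Lemma aq_mul1q : left_id aq_one aq_mul.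
Proof. by elim/aq_piS=> a; rewrite -aq_piM mul1r. Qed.

Lemma aq_mulq1 : right_id aq_one aq_mul.
Proof. by elim/aq_piS=> a; rewrite -aq_piM mulr1. Qed.

Lemma aq_mulDl : left_distributive aq_mul +%R.
Proof.
elim/aq_piS=> a; elim/aq_piS=> b; elim/aq_piS=> c.
by rewrite -!aq_piM -!aq_piD -!aq_piM mulrDl.
Qed.

Lemma aq_mulDr : right_distributive aq_mul +%R.
Proof.
elim/aq_piS=> a; elim/aq_piS=> b; elim/aq_piS=> c.
by rewrite -!aq_piM -!aq_piD -!aq_piM mulrDr.
Qed.

Lemma aq_one_neq0 : aq_one != 0.
Proof.
rewrite -aq_pi0; apply/eqP => /aq_piP.
by rewrite subr0 (negPf two_sided_ideal_subproof.1).
Qed.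

HB.instance Definition _ := GRing.Zmodule_isNzRing.Build alg_quot
  aq_mulA aq_mul1q aq_mulq1 aq_mulDl aq_mulDr aq_one_neq0.

Lemma aq_scaleA l m q : aq_scale l (aq_scale m q) = aq_scale (l * m) q.
Proof. by elim/aq_piS: q => a; rewrite -!aq_piZ scalerA. Qed.

Lemma aq_scale1 : left_id 1 aq_scale.
Proof. by elim/aq_piS=> a; rewrite -aq_piZ scale1r. Qed.

Lemma aq_scaleDr : right_distributive aq_scale +%R.
Proof.
move=> l; elim/aq_piS=> a; elim/aq_piS=> b.
by rewrite -!aq_piZ -!aq_piD -!aq_piZ scalerDr.
Qed.

Lemma aq_scaleDl q : {morph aq_scale^~ q : l m / l + m}.
Proof.
by move=> l m; elim/aq_piS: q => a; rewrite -!aq_piZ -aq_piD scalerDl.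
Qed.

HB.instance Definition _ := GRing.Zmodule_isLmodule.Build k alg_quot
  aq_scaleA aq_scale1 aq_scaleDr aq_scaleDl.

Lemma aq_scaleAl (l : k) q r : l *: (q * r) = l *: q * r.
Proof.
elim/aq_piS: q => a; elim/aq_piS: r => b; change
  (aq_scale l (aq_mul (\pi_Q a) (\pi_Q b)) =
   aq_mul (aq_scale l (\pi_Q a)) (\pi_Q b)).
by rewrite -aq_piM -!aq_piZ -aq_piM scalerAl.
Qed.

HB.instance Definition _ := GRing.Lmodule_isLalgebra.Build k alg_quot aq_scaleAl.

Lemma aq_scaleAr (l : k) q r : l *: (q * r) = q * (l *: r).
Proof.
elim/aq_piS: q => a; elim/aq_piS: r => b; change
  (aq_scale l (aq_mul (\pi_Q a) (\pi_Q b)) =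
   aq_mul (\pi_Q a) (aq_scale l (\pi_Q b))).
by rewrite -aq_piM -!aq_piZ -aq_piM scalerAr.
Qed.

HB.instance Definition _ := GRing.Lalgebra_isAlgebra.Build k alg_quot aq_scaleAr.

End AlgQuotient.

Definition central (R : nzRingType) (z : R) : Prop := forall a, GRing.comm z a.

Definition finite_over_center (R : nzRingType) : Prop :=
  exists (n : nat) (b : 'I_n -> R), forall a : R,
    exists2 c : 'I_n -> R, (forall i, central (c i)) &
      a = \sum_(i < n) c i * b i.

(* The relations l = r of H(gl(1,1)) = U(gl(1,1)) # k C_2, as elements l - r. *)
Definition gl11_relators (R : nzRingType) (x y u v t : R) : seq R :=
  [:: x * y - y * x; x * u - u * x; x * v - v * x;
      y * u - u * y - u; y * v - v * y + v;
      u ^+ 2; v ^+ 2; u * v + v * u - x;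
      t ^+ 2 - 1; t * x - x * t; t * y - y * t;
      t * u + u * t; t * v + v * t].

Lemma gl11_relators_map (R S : nzRingType) (f : {rmorphism R -> S}) x y u v t :
  [seq f r | r <- gl11_relators x y u v t] =
  gl11_relators (f x) (f y) (f u) (f v) (f t).
Proof. by rewrite /= !(rmorphD, rmorphN, rmorphXn, rmorphM, rmorph1). Qed.

Inductive gl11_gen := Gx | Gy | Gu | Gv | Gt.

Definition nat_of_gl11_gen (g : gl11_gen) : nat :=
  match g with Gx => 0 | Gy => 1 | Gu => 2 | Gv => 3 | Gt => 4 end.
Definition gl11_gen_of_nat (n : nat) : gl11_gen :=
  nth Gx [:: Gx; Gy; Gu; Gv; Gt] n.
Lemma nat_of_gl11_genK : cancel nat_of_gl11_gen gl11_gen_of_nat.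
Proof. by case. Qed.

HB.instance Definition _ := Countable.copy gl11_gen (can_type nat_of_gl11_genK).

Lemma malg_scaleAr (M : monomType) (R : comNzRingType) (l : R)
  (a b : {malg R[M]}) : l *: (a * b) = a * (l *: b).
Proof.
rewrite -!mul_malgC !mulrA; congr (_ * b).
rewrite [LHS]fgmulUg [RHS]fgmulgU; apply: eq_bigr => m _.
by rewrite mulrC mulm1 mul1m.
Qed.

Section Hgl11.
Variable k : fieldType.

(* The free associative unital k-algebra on the five generators: the monoid
   algebra of the free monoid of words. *)
Definition gl11_free := {malg k[{fmonom gl11_gen}]}.
HB.instance Definition _ := GRing.Lalgebra.on gl11_free.

HB.instance Definition _ :=
  GRing.Lalgebra_isAlgebra.Build k gl11_free (@malg_scaleAr _ k).

Local Notation "''g' g" := (<< fmu g >> : gl11_free) (at level 8, g at level 2).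

Definition Hgl11_rels : seq gl11_free :=
  gl11_relators 'g Gx 'g Gy 'g Gu 'g Gv 'g Gt.

Definition Hgl11_ideal : {pred gl11_free} :=
  fun a => `[< ideal_gen Hgl11_rels a >].

Lemma Hgl11_ideal_zmod_closed : zmod_closed Hgl11_ideal.
Proof.
split=> [|a b /asboolP Ia /asboolP Ib]; apply/asboolP.
  exact: ideal_gen0.
exact: ideal_genB.
Qed.
HB.instance Definition _ :=
  GRing.isZmodClosed.Build gl11_free Hgl11_ideal Hgl11_ideal_zmod_closed.

(* The ideal is proper: every relator is killed by the character of the free
   algebra with x, y, u, v |-> 0 and t |-> 1. *)
Definition gl11_char (m : {fmonom gl11_gen}) : k :=
  \prod_(g <- (m : seq gl11_gen)) (g == Gt)%:R.

Lemma gl11_char_mmorphism : mmorphism gl11_char.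
Proof.
split=> [m1 m2|]; first by rewrite /gl11_char fmM big_cat.
by rewrite /gl11_char fm1 big_nil.
Qed.
HB.instance Definition _ := isMultiplicative.Build
  {fmonom gl11_gen} k gl11_char gl11_char_mmorphism.

Lemma Hgl11_ideal1 : 1 \notin Hgl11_ideal.
Proof.
have [e eg] : exists e : {rmorphism gl11_free -> k},
    forall g, e 'g g = (g == Gt)%:R.
  exists (mmap idfun gl11_char) => g.
  by rewrite [LHS]mmapU /= mul1r /gl11_char fmU big_seq1.
suff eI a : ideal_gen Hgl11_rels a -> e a = 0.
  by apply/asboolP => /eI /eqP; rewrite rmorph1 oner_eq0.
have erels : map e Hgl11_rels = gl11_relators 0 0 0 0 1.
  by rewrite (gl11_relators_map e) !eg.
elim=> {a} [a /(map_f e)||a b _ a0 _ b0|a b c _ b0].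
- rewrite erels /gl11_relators !expr2 !(mulr1, mul1r, mulr0, subrr, addr0).
  by rewrite !inE !orbb => /eqP.
- exact: rmorph0.
- by rewrite rmorphB a0 b0 subrr.
- by rewrite !rmorphM b0 mulr0 mul0r.
Qed.

Lemma Hgl11_idealM a b :
  b \in Hgl11_ideal -> a * b \in Hgl11_ideal /\ b * a \in Hgl11_ideal.
Proof.
move=> /asboolP Ib; split; apply/asboolP.
  by rewrite -[a * b]mulr1; exact: ideal_genM.
by rewrite -[b]mul1r; exact: ideal_genM.
Qed.

HB.instance Definition _ := isTwoSidedIdeal.Build gl11_free Hgl11_ideal
  (conj Hgl11_ideal1 Hgl11_idealM).

Definition Hgl11 := alg_quot Hgl11_ideal.
HB.instance Definition _ := GRing.Algebra.on Hgl11.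

End Hgl11.

(* Main.v *)
(** For a scalar p and a sign s, H acts on k^2 by lower triangular matrices:
    x and u act as 0, v as e_21, y as diag(p, p-1) and t as diag(s, -s).
    The diagonal entries of this action are the characters chi_(s,p) and
    chi_(-s,p-1). A central element commutes with v, hence has equal diagonal
    entries, so applying this twice gives chi_(s,p) = chi_(s,p-2) on the center.
    If b_1, ..., b_n spanned H over its center, the n+1 functions
    i |-> chi_(1,-2i)(y^j) = (-2i)^j, for 0 <= j <= n, would lie in the k-span of
    the n functions i |-> chi_(1,-2i)(b_l). In characteristic 0 this contradicts
    the invertibility of the Vandermonde matrix at the points 0, -2, ..., -2n. *)
Require Import Defs.
From mathcomp Require Import all_boot all_order all_algebra.
From HB Require Import structures.
From mathcomp Require Import generic_quotient boolp monalg ring.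

Set Implicit Arguments.
Unset Strict Implicit.
Unset Printing Implicit Defensive.

Import GRing.Theory.
Local Open Scope ring_scope.
Local Open Scope quotient_scope.

Lemma sum_ord2 (R : nmodType) (F : 'I_2 -> R) : \sum_(i < 2) F i = F 0 + F 1.
Proof.
by rewrite !big_ord_recl big_ord0 addr0; congr (_ + F _); exact: val_inj.
Qed.

Section Representations.
Variable k : fieldType.

Definition free_gen (g : gl11_gen) : gl11_free k := << fmu g >>.

(* Typing the projection with [Hgl11 k] rather than [alg_quot _] lets the
   canonical structures of [Hgl11] be inferred on its values. *)
Definition Hpi : gl11_free k -> Hgl11 k := \pi_(Hgl11 k).
Definition Hgen (g : gl11_gen) : Hgl11 k := Hpi (free_gen g).

Lemma HpiS (P : Hgl11 k -> Prop) : (forall a, P (Hpi a)) -> forall q, P q.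
Proof. exact: aq_piS. Qed.

Lemma Hpi_additive : additive Hpi.
Proof.
move=> a b; apply: (addIr (Hpi b)).
by rewrite subrK -[LHS](aq_piD (@Hgl11_ideal k)) subrK.
Qed.

Lemma Hpi_monoid_morphism : GRing.monoid_morphism Hpi.
Proof. by split=> // a b; exact: (aq_piM (@Hgl11_ideal k)). Qed.

Lemma Hpi_scalable : scalable Hpi.
Proof. exact: (aq_piZ (@Hgl11_ideal k)). Qed.

HB.instance Definition _ := GRing.isZmodMorphism.Build _ _ Hpi Hpi_additive.
HB.instance Definition _ :=
  GRing.isMonoidMorphism.Build _ _ Hpi Hpi_monoid_morphism.
HB.instance Definition _ := GRing.isScalable.Build _ _ _ _ Hpi Hpi_scalable.

(** Elements lift to the free algebra, where they are linear combinations of words, and words are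
    products of generators. *)
Lemma Hgl11_ind (P : Hgl11 k -> Prop) :
    P 1 -> (forall a b, P a -> P b -> P (a + b)) ->
    (forall (l : k) a, P a -> P (l *: a)) ->
    (forall a b, P a -> P b -> P (a * b)) -> (forall g, P (Hgen g)) ->
  forall a, P a.
Proof.
move=> P1 PD PZ PM Pg; elim/HpiS => a.
have P0 : P (Hpi 0) by rewrite rmorph0 -(scale0r 1); exact: PZ.
rewrite [a]monalgE; elim/big_ind: _ => // [b c Pb Pc|m _].
  by rewrite rmorphD; exact: PD.
have -> : << a@_m *g m >> = a@_m *: << m >> :> gl11_free k.
  by rewrite -mul_malgC [RHS]fgmulUU mulr1 mul1m.
rewrite linearZ; apply: PZ.
rewrite -[m]fmK; elim: (m : seq _) => [|g s IHs].
  by rewrite -[FMonom _]fmoneE.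
have -> : << FMonom (g :: s) >> = free_gen g * << FMonom s >> :> gl11_free k.
  rewrite [RHS]fgmulUU mulr1; congr << _ >>.
  by apply/eqP; rewrite fmP fmM fmU.
rewrite rmorphM; exact: PM _ _ (Pg g) IHs.
Qed.

(** Universal property of the presentation: evaluation of words, extended linearly, kills the ideal
    of relations. *)
Lemma Hgl11_lift (A : algType k) (F : gl11_gen -> A) :
    {in gl11_relators (F Gx) (F Gy) (F Gu) (F Gv) (F Gt), forall r, r = 0} ->
  {f : {lrmorphism Hgl11 k -> A} | forall g, f (Hgen g) = F g}.
Proof.
move=> relF.
pose h (m : {fmonom gl11_gen}) : A := \prod_(g <- (m : seq gl11_gen)) F g.
have h_mm : mmorphism h.
  by split=> [m1 m2|]; rewrite /h ?fmM ?big_cat // fm1 big_nil.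
pose hM : {mmorphism {fmonom gl11_gen} -> A} :=
  HB.pack h (isMultiplicative.Build _ _ h h_mm).
have e_mul : GRing.monoid_morphism (mmap (in_alg A) hM).
  (* [A] need not be commutative; it suffices that the scalars commute with the images of words. *)
  have [|eM e1] := @commr_mmap_is_multiplicative _ _ _ (in_alg A) hM.
    by move=> a m m'; rewrite /GRing.comm mulr_algl mulr_algr.
  by split.
pose e : {rmorphism gl11_free k -> A} := HB.pack (mmap (in_alg A) hM)
  (GRing.isMonoidMorphism.Build _ _ _ e_mul).
have e_gen g : e (free_gen g) = F g.
  by rewrite [LHS]mmapU /= scale1r mul1r /h fmU big_seq1.
have eZ l a : e (l *: a) = l *: e a.
  by rewrite -mul_malgC rmorphM [X in X * _]mmapC /= mulr_algl.
have e_ideal a : ideal_gen (Hgl11_rels k) a -> e a = 0.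
  elim=> {a} [a /(map_f e)||a b _ a0 _ b0|a b c _ b0].
  - by rewrite [map _ _](gl11_relators_map e) !e_gen => /relF.
  - exact: rmorph0.
  - by rewrite rmorphB a0 b0 subrr.
  - by rewrite !rmorphM b0 mulr0 mul0r.
(* The choice of representative is harmless, since two of them differ by an element of the ideal. *)
pose f (q : Hgl11 k) : A := e (repr q).
have f_pi a : f (Hpi a) = e a.
  apply/esym/eqP; rewrite -subr_eq0 -rmorphB; apply/eqP/e_ideal/asboolP.
  exact: (aq_piK (@Hgl11_ideal k)).
have fB : additive f.
  by elim/HpiS=> a; elim/HpiS=> b; rewrite -rmorphB !f_pi rmorphB.
have fM : GRing.monoid_morphism f.
  split; first by rewrite -(rmorph1 Hpi) f_pi rmorph1.
  by elim/HpiS=> a; elim/HpiS=> b; rewrite -rmorphM !f_pi rmorphM.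
have fZ : scalable f.
  by move=> l; elim/HpiS=> a; rewrite -linearZ !f_pi eZ.
pose fLR : {lrmorphism Hgl11 k -> A} := HB.pack f
  (GRing.isZmodMorphism.Build _ _ f fB) (GRing.isMonoidMorphism.Build _ _ f fM)
  (GRing.isScalable.Build _ _ _ _ f fZ).
by exists fLR => g; rewrite [LHS]f_pi e_gen.
Qed.

(* [b] encodes the sign s = (-1)^b by which [t] acts on the first vector. *)
Definition rho_gen (b : bool) (p : k) (g : gl11_gen) : 'M[k]_2 :=
  match g with
  | Gx | Gu => 0
  | Gy => diag_mx (\row_i (if i == 0 then p else p - 1))
  | Gv => delta_mx 1 0
  | Gt => diag_mx (\row_i (if i == 0 then (-1) ^+ b else - (-1) ^+ b))
  end.

Lemma rho_rels b p : {in gl11_relators (rho_gen b p Gx) (rho_gen b p Gy)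
  (rho_gen b p Gu) (rho_gen b p Gv) (rho_gen b p Gt), forall r, r = 0}.
Proof.
have ss : (-1) ^+ b * (-1) ^+ b = 1 :> k by rewrite -signr_addb addbb.
suff /allP rel0 : all (pred1 0) (gl11_relators (rho_gen b p Gx)
    (rho_gen b p Gy) (rho_gen b p Gu) (rho_gen b p Gv) (rho_gen b p Gt)).
  by move=> r /rel0 /eqP.
rewrite /= !expr2 !(mulr0, mul0r, subrr, addr0, subr0) eqxx /=.
do ![apply/andP; split=> //]; apply/eqP/matrixP => i j.
all: rewrite !mxE !sum_ord2 !mxE /=.
all: case: i => [[|[|[]]] // ?]; case: j => [[|[|[]]] // ?] /=.
all: ring: ss.
Qed.

Definition rho (b : bool) (p : k) : {lrmorphism Hgl11 k -> 'M[k]_2} :=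
  sval (Hgl11_lift (@rho_rels b p)).

Lemma rhoE b p g : rho b p (Hgen g) = rho_gen b p g.
Proof. exact: (svalP (Hgl11_lift (@rho_rels b p))). Qed.

(** Lower triangular matrices form a subalgebra containing the images of the generators. This is
    what makes the diagonal entries multiplicative. *)
Lemma rho_lower b p a : rho b p a 0 1 = 0.
Proof.
elim/Hgl11_ind: a => [|a c a0 c0|l a a0|a c a0 c0|g].
- by rewrite rmorph1 !mxE.
- by rewrite rmorphD mxE a0 c0 addr0.
- by rewrite linearZ mxE a0 mulr0.
- by rewrite rmorphM mxE sum_ord2 c0 a0; ring.
- by rewrite rhoE; case: g; rewrite /= !mxE.
Qed.

Definition chi b p (a : Hgl11 k) : k := rho b p a 0 0.

Lemma chiD b p : {morph chi b p : a c / a + c}.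
Proof. by move=> a c; rewrite /chi rmorphD mxE. Qed.

Lemma chi1 b p : chi b p 1 = 1.
Proof. by rewrite /chi rmorph1 mxE. Qed.

Lemma chiM b p : {morph chi b p : a c / a * c}.
Proof.
move=> a c; rewrite /chi rmorphM mxE sum_ord2.
by rewrite rho_lower mul0r addr0.
Qed.

Lemma chi_y b p n : chi b p (Hgen Gy ^+ n) = p ^+ n.
Proof.
elim: n => [|n IHn]; first exact: chi1.
by rewrite !exprS chiM IHn /chi rhoE !mxE.
Qed.

(** Both sides are characters, so comparing them on the generators suffices. *)
Lemma rho11 b p a : rho b p a 1 1 = chi (~~ b) (p - 1) a.
Proof.
elim/Hgl11_ind: a => [|a c aE cE|l a aE|a c aE cE|g].
- by rewrite rmorph1 chi1 mxE.
- by rewrite rmorphD mxE aE cE chiD.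
- by rewrite linearZ mxE aE /chi linearZ mxE.
- rewrite chiM -aE -cE rmorphM mxE sum_ord2.
  by rewrite rho_lower mulr0 add0r.
- by rewrite /chi !rhoE; case: g; rewrite /= !mxE ?signrN //= signrN.
Qed.

(** As [v] acts by [e_21], the lower left entry of [z * v = v * z] equates the two diagonal entries
    of [rho b p z]. *)
Lemma central_chi_shift b p z : central z -> chi b p z = chi (~~ b) (p - 1) z.
Proof.
move=> /(_ (Hgen Gv)) /(congr1 (rho b p)).
rewrite [LHS]rmorphM [RHS]rmorphM /= !rhoE => /matrixP /(_ 1 0).
rewrite -rho11 /chi !mxE !sum_ord2 !mxE /=.
by rewrite !(mulr0, mulr1, mul1r, mul0r, add0r, addr0).
Qed.

Lemma central_chi_const b p z n :
  central z -> chi b (p - n.*2%:R) z = chi b p z.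
Proof.
move=> zC; elim: n => [|n <-]; first by rewrite subr0.
(* Two shifts restore the sign, whence the steps of 2. *)
do 2![rewrite [RHS](central_chi_shift _ _ zC)]; rewrite negbK.
by congr (chi b _ z); rewrite doubleS -addn2 natrD; ring.
Qed.

End Representations.

Theorem theorem2 (k : closedFieldType) (char0 : [pchar k]%R =i pred0) :
  ~ finite_over_center (Hgl11 k).
Proof.
move=> [n [b genb]].
pose pt i : k := 0 - i.*2%:R.
have [c cC cE] : exists2 c : 'I_n.+1 -> 'I_n -> Hgl11 k,
    forall j i, central (c j i) &
    forall j : 'I_n.+1, Hgen k Gy ^+ j = \sum_(i < n) c j i * b i.
  have /fin_all_exists2[c cC cE] (j : 'I_n.+1) :
    exists2 c : 'I_n -> Hgl11 k, forall i, central (c i) &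
      Hgen k Gy ^+ j = \sum_(i < n) c i * b i by exact: genb.
  by exists c.
pose V := Vandermonde n.+1 (\row_(i < n.+1) pt i).
(* On the central coefficients every point [pt i] acts as 0 does, so the left factor does not depend
   on [i] and [V] factors through [k^n]. *)
have VE : V = (\matrix_(j < n.+1, l < n) chi false 0 (c j l)) *m
              (\matrix_(l < n, i < n.+1) chi false (pt i) (b l)).
  apply/matrixP => j i; rewrite !mxE -(chi_y false) cE.
  rewrite (big_morph _ (chiD _ _) (_ : _ = 0)); last by rewrite /chi rmorph0 mxE.
  by apply: eq_bigr => l _; rewrite !mxE chiM (central_chi_const _ _ _ (cC _ _)).
have : V \in unitmx.
  rewrite unitmxE unitfE det_Vandermonde; apply/prodf_neq0 => i _; apply/prodf_neq0 => j ij.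
  (* Up to sign, two nodes differ by the nonzero natural number [2(j - i)]. *)
  rewrite !mxE /pt !sub0r opprK addrC -opprB oppr_eq0 -natrB ?leq_double ?(ltnW ij) //.
  by have /pcharf0P -> := char0; rewrite -lt0n subn_gt0 ltn_double.
(* The factorization bounds the rank by [n], while invertibility demands [n.+1]. *)
rewrite -row_free_unit /row_free VE ltn_eqF // ltnS.
by rewrite (leq_trans (mxrankM_maxr _ _)) ?rank_leq_row.
Qed.
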